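(* Let $a<b$, $x_a,x_b>0$, and let $\gamma$ be a kinetically admissible path on $[a,b]$ with $\gamma(a)=x_a$ and $\gamma(b)=x_b$. Let $\gamma_*(t)=\exp\bigl(\log x_a+\frac{t-a}{b-a}(\log x_b-\log x_a)\bigr)$, and set $\eta:=\log\gamma-\log\gamma_*\in H^1_0([a,b])$ (so $\eta(a)=\eta(b)=0$). Then $$\mathcal{A}[\gamma]-\mathcal{A}[\gamma_*]\;\ge\;\tfrac12\int_a^b\dot\eta(t)^2\,dt\;\ge\;\frac{\pi^2}{2(b-a)^2}\int_a^b\eta(t)^2\,dt=\frac{\pi^2}{2(b-a)^2}\,\bigl\|\log(\gamma/\gamma_* )\bigr\|_{L^2([a,b])}^2.$$ The constant $\pi^2/(b-a)^2$ is the optimal constant $C$ in the inequality $\int_a^b\dot\eta^2\,dt\ge C\int_a^b\eta^2\,dt$ on $H^1_0([a,b])$, attained by $\eta(t)=\sin(\pi(t-a)/(b-a))$.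
   Context: For $a<b$, an admissible path on $[a,b]$ is an absolutely continuous function $\gamma:[a,b]\to(0,\infty)$ (strictly positive at every point) with $\dot\gamma\in L^2([a,b])$. Its log-coordinate is $\xi:=\log\gamma$, which is absolutely continuous with $\dot\xi=\dot\gamma/\gamma\in L^2([a,b])$. An admissible path $\gamma$ is kinetically admissible if $\int_a^b[\cosh(\dot\xi(t))-1]\,dt<\infty$. For a kinetically admissible path the kinetic action is $\mathcal{A}[\gamma]:=\int_a^b[\cosh(\dot\xi(t))-1]\,dt$. $H^1_0([a,b])$ is the space of absolutely continuous functions on $[a,b]$ with $L^2$ derivative vanishing at both endpoints. *)

(* Defs.v *)
From HB Require Import structures.
From mathcomp Require Export all_boot all_order all_algebra.
From mathcomp Require Export all_classical all_reals all_analysis.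

Set Implicit Arguments.
Unset Strict Implicit.
Unset Printing Implicit Defensive.

Export Order.TTheory GRing.Theory Num.Theory.
Export numFieldNormedType.Exports.

Local Open Scope classical_set_scope.
Local Open Scope ring_scope.

(* A function on [a, b] is represented by a total function R -> R of which only
   the values on `[a, b] matter.  The derivative of an absolutely continuous
   function is its pointwise derivative derive1 f, which exists almost everywhere on
   [a, b]; it takes the default value 0 where the difference quotients do not
   converge, and the values of f outside [a, b] can only affect it at the points
   a and b of [a, b]. *)

Section paths.
Variable R : realType.
Implicit Types (a b x C t : R) (f gamma eta : R -> R).

Local Notation mu := (@lebesgue_measure R).

Definition cosh x : R := (expR x + expR (- x)) / 2.

Definition absolutely_continuous a b f : Prop :=
  forall e : R, 0 < e -> exists2 d : R, 0 < d &
    forall (n : nat) (l r : 'I_n -> R),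
      (forall i, [/\ a <= l i, l i <= r i & r i <= b]) ->
      trivIset setT (fun i => `]l i, r i[%classic) ->
      \sum_(i < n) (r i - l i) < d ->
      \sum_(i < n) `|f (r i) - f (l i)| < e.

Definition L2 a b f : Prop := (f \_ `[a, b]) \in Lfun mu 2%:E.

Definition L2norm a b f : \bar R := Lnorm mu 2%:E (EFin \o (f \_ `[a, b])).

Definition H10 a b f : Prop :=
  [/\ absolutely_continuous a b f, L2 a b (derive1 f), f a = 0 & f b = 0].

Definition admissible a b gamma : Prop :=
  [/\ absolutely_continuous a b gamma,
      {in `[a, b], forall t, 0 < gamma t} &
      L2 a b (derive1 gamma)].

Definition log_coord gamma : R -> R := fun t => ln (gamma t).

(* The integrand is nonnegative, so that the integral is defined in [0, +oo]. *)
Definition kinetic_action a b gamma : \bar R :=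
  (\int[mu]_(t in `[a, b]) (cosh (derive1 (log_coord gamma) t) - 1)%:E)%E.

Definition kinetically_admissible a b gamma : Prop :=
  admissible a b gamma /\ (kinetic_action a b gamma < +oo)%E.

Definition gamma_star a b xa xb : R -> R :=
  fun t => expR (ln xa + (t - a) / (b - a) * (ln xb - ln xa)).

Definition poincare_inequality a b C : Prop :=
  forall eta, H10 a b eta ->
    (\int[mu]_(t in `[a, b]) (derive1 eta t ^+ 2)%:E >=
     C%:E * \int[mu]_(t in `[a, b]) (eta t ^+ 2)%:E)%E.

Definition sine_arch a b : R -> R := fun t => sin (pi * (t - a) / (b - a)).

End paths.

(* Main.v *)
From HB Require Import structures.
From mathcomp Require Import ring lra measurable_realfun.
Require Import Defs.

(* Write v for the constant slope of log gamma_*.  Almost everywhere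
   (log gamma)' = v + eta', and cosh'' >= 1 gives
   cosh (v + h) >= cosh v + (sinh v) h + h^2 / 2; as the integral of eta' is
   eta b - eta a = 0, integrating gives the first inequality.
   The second one is Poincare's: for 0 < c < pi / (b - a) the function
   psi = - c tan (c (t - (a + b) / 2)) is smooth on [a, b], satisfies
   psi' = - c^2 - psi^2, and integrating
   eta'^2 - c^2 eta^2 - (eta^2 psi)' = (eta' - eta psi)^2 >= 0
   gives the inequality with constant c^2; then c tends to pi / (b - a).
   Both steps integrate the pointwise derivative of an absolutely continuous
   function f.  By the Jordan decomposition through the total variation,
   f = p - q with p and q nondecreasing and absolutely continuous; their
   Stieltjes measures are dominated by Lebesgue measure, so that f is the
   primitive of a difference of Radon-Nikodym densities, which is
   its derivative almost everywhere by Lebesgue's differentiation theorem. *)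

Set Implicit Arguments.
Unset Strict Implicit.
Unset Printing Implicit Defensive.

Local Open Scope classical_set_scope.
Local Open Scope ring_scope.

(** * Jordan decomposition of absolutely continuous functions *)

Section absolute_continuity.
Variable R : realType.
Implicit Types (a b d e x y : R) (f : R -> R) (p q : R * R)
  (l : seq R) (s : seq (R * R)).

(** Families of intervals are handled as lists of endpoint pairs, which can be concatenated and
    refined by induction. Neighbours may share an endpoint: only the open interiors have to be
    disjoint. *)
Definition apart p q := (p.2 <= q.1) || (q.2 <= p.1).

Definition subitv a b p := [&& a <= p.1, p.1 <= p.2 & p.2 <= b].

Definition nonoverlapping a b s := all (subitv a b) s && pairwise apart s.

Definition total_length s : R := \sum_(p <- s) (p.2 - p.1).

Definition jumps f s : R := \sum_(p <- s) `|f p.2 - f p.1|.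

Lemma apart_sym : symmetric apart.
Proof. by move=> p q; rewrite /apart orbC. Qed.

Lemma apart_disjoint p q : apart p q ->
  `]p.1, p.2[%classic `&` `]q.1, q.2[%classic = set0.
Proof.
move=> pq; rewrite -subset0 => z [] /=.
rewrite !in_itv/= => /andP[p1 p2] /andP[q1 q2].
case/orP: pq => pq.
- by move: (lt_trans q1 p2); rewrite ltNge pq.
- by move: (lt_trans p1 q2); rewrite ltNge pq.
Qed.

(** The family indexed by ['I_n] is read off the list with [nth]; entries that are pairwise [apart]
    have disjoint open intervals. *)
Lemma absolutely_continuous_seq a b f : absolutely_continuous a b f ->
  forall e, 0 < e -> exists2 d, 0 < d &
    forall s, nonoverlapping a b s -> total_length s < d -> jumps f s < e.
Proof.
move=> acf e /acf[d d0 Hd]; exists d => // s /andP[/allP sab ps] sd.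
pose z : R * R := (0, 0).
have := Hd (size s) (fun i => (nth z s i).1) (fun i => (nth z s i).2).
have -> : \sum_(i < size s) ((nth z s i).2 - (nth z s i).1) = total_length s.
  by rewrite /total_length (big_nth z) big_mkord.
have -> : \sum_(i < size s) `|f (nth z s i).2 - f (nth z s i).1| = jumps f s.
  by rewrite /jumps (big_nth z) big_mkord.
apply => //.
- by move=> i; have /and3P[] := sab _ (mem_nth z (ltn_ord i)).
- move=> i j _ _; apply: contraPP => ij.
  suff -> : `](nth z s i).1, (nth z s i).2[%classic `&`
            `](nth z s j).1, (nth z s j).2[%classic = set0 by case.
  move/pairwiseP : ps => /(_ z) ps.
  case: (ltngtP i j) => [lij|lji|/val_inj//].
  + by apply/apart_disjoint/ps; rewrite ?inE.
  + by rewrite setIC; by apply/apart_disjoint/ps; rewrite ?inE.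
Qed.

Definition steps x l := zip (x :: l) l.

(** Turns a partition, as used by the total variation, into a family to which absolute continuity
    applies. *)
Lemma steps_spec f x y l : itv_partition x y l ->
  [/\ nonoverlapping x y (steps x l), total_length (steps x l) = y - x &
      jumps f (steps x l) = variation x y f l].
Proof.
move=> xyl; split.
- elim: l x xyl => //= z l ih x xyl.
  have [/= /andP[xz _] _] := xyl.
  have zyl := itv_partition_cons xyl.
  have /andP[sl pl] := ih _ zyl.
  have zy := itv_partition_le zyl.
  rewrite /nonoverlapping /= /subitv/= lexx (ltW xz) zy/= -/(steps z l) pl andbT.
  apply/andP; split.
    apply: sub_all sl => p /and3P[zp1 p12 p2y].
    by rewrite /subitv (le_trans (ltW xz))//= p12.
  by apply: sub_all sl => p /and3P[zp1 p12 p2y]; rewrite /apart zp1.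
- elim: l x xyl => /= [x|z l ih x xyl].
    by move=> /itv_partition_nil ->; rewrite /total_length big_nil subrr.
  rewrite /total_length/= big_cons -/(steps z l).
  by have := ih _ (itv_partition_cons xyl); rewrite /total_length => -> /=; ring.
- rewrite variation_zip//; elim: l x xyl => /= [x _|z l ih x xyl].
    by rewrite /jumps !big_nil.
  rewrite /jumps/= !big_cons -/(steps z l).
  by congr (_ + _); exact: ih (itv_partition_cons xyl).
Qed.

End absolute_continuity.

(** * Total variation of absolutely continuous functions *)

Section jordan_decomposition.
Variable R : realType.
Implicit Types (a b d e x y : R) (f : R -> R) (p : R * R)
  (r s t : seq (R * R)).

(** Subintervals of [p] inherit from [p] their separation from the other intervals, so [p] may be
    replaced by any nonoverlapping family inside it. *)
Lemma nonoverlapping_refine a b p r s t : nonoverlapping a b (p :: s ++ t) ->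
  nonoverlapping p.1 p.2 r -> nonoverlapping a b (s ++ (r ++ t)).
Proof.
rewrite /nonoverlapping /= !all_cat !pairwise_cat !allrel_catr.
move=> /andP[/and3P[/and3P[ap p12 pb] sab tab]].
move=> /andP[/andP[/allP ps /allP pt] /and3P[st ss tt]] /andP[/allP rp rr].
have apart_r z q : z \in r -> apart p q -> apart z q.
  move=> /rp /and3P[pz z12 zp] /orP[pq|qp]; apply/orP; [left|right].
  - exact: le_trans pq.
  - exact: le_trans pz.
rewrite sab tab st ss tt rr !andbT/=; apply/and3P; split.
- apply/allP => q /rp /and3P[pq q12 qp].
  by rewrite /subitv (le_trans ap pq) q12 (le_trans qp pb).
- by apply/allrelP => q z qs zr; rewrite apart_sym; apply: apart_r (ps _ qs).
- by apply/allrelP => z q zr qt; apply: apart_r (pt _ qt).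
Qed.

(* Each interval of [s] is in turn replaced by an arbitrary partition of it,
   which keeps the total length. *)
Lemma total_variation_jumps_le a b f d e :
    (forall s, nonoverlapping a b s -> total_length s < d -> jumps f s <= e) ->
  forall s t, nonoverlapping a b (s ++ t) -> total_length (s ++ t) < d ->
  (\sum_(p <- s) total_variation p.1 p.2 f + (jumps f t)%:E <= e%:E)%E.
Proof.
move=> fde; elim=> [t abt td|p s ih t abpst pstd].
  by rewrite big_nil add0e lee_fin; exact: fde.
have abst : nonoverlapping a b (s ++ t).
  by move: abpst; rewrite /nonoverlapping => /andP[/= /andP[_ ->] /andP[_ ->]].
have p12 : p.1 <= p.2 by move: abpst => /andP[/= /andP[/and3P[]]].
have lenE : total_length (p :: s ++ t) = p.2 - p.1 + total_length (s ++ t).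
  by rewrite /total_length big_cons.
have rest_le := ih t abst.
rewrite big_cons -addeA; set rest := (X in (_ + X)%E).
have rest0 : (0 <= rest)%E.
  rewrite adde_ge0 ?lee_fin ?sumr_ge0// big_seq sume_ge0// => q qs.
  apply: total_variation_ge0.
  by move: abst => /andP[+ _]; rewrite all_cat => /andP[/allP/(_ _ qs)/and3P[]].
(* Finiteness of [rest] allows the subtraction that isolates the variation over [p]; the supremum is
   then bounded one partition at a time. *)
have rest_fin : rest \is a fin_num.
  rewrite ge0_fin_numE// (@le_lt_trans _ _ e%:E) ?ltry// rest_le//.
  by rewrite (le_lt_trans _ pstd)//= lenE lerDr subr_ge0.
rewrite -leeBrDr// /total_variation.
apply: ge_ereal_sup => _ [v [l pl <-] <-]; rewrite leeBrDr//.
have [rp rlen rvar] := steps_spec f pl.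
(* The partition of [p] joins the intervals already cut, which is why the induction is general in
   [t]. *)
have := ih (steps p.1 l ++ t) (nonoverlapping_refine abpst rp).
rewrite /rest addeCA -rvar -EFinD /jumps !big_cat/=; apply.
move: pstd; rewrite lenE -rlen /total_length !big_cat/=.
by rewrite (addrCA (\sum_(i <- steps _ _) _)).
Qed.

(** Cut [a, b] into N + 1 pieces shorter than [d]: by additivity the total variation is at most N +
    1. *)
Lemma small_total_variation_bounded a b f d : a <= b -> 0 < d ->
  (forall x y, a <= x -> x <= y -> y <= b -> y - x < d ->
    (total_variation x y f <= 1%:E)%E) ->
  bounded_variation a b f.
Proof.
move=> ab d0 Hd.
have [N Nd] : exists N : nat, (b - a) / N.+1%:R < d.
  exists (Num.bound ((b - a) / d)); rewrite ltr_pdivrMr// mulrC -ltr_pdivrMr//.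
  rewrite (lt_trans (archi_boundP _))//; last by rewrite ltr_nat.
  by rewrite divr_ge0 ?subr_ge0// ltW.
pose z k : R := a + k%:R * ((b - a) / N.+1%:R).
have step0 : 0 <= (b - a) / N.+1%:R by rewrite divr_ge0// subr_ge0.
have zS k : z k.+1 = z k + (b - a) / N.+1%:R.
  by rewrite /z -natr1 mulrDl mul1r addrA.
have az k : a <= z k by rewrite lerDl mulr_ge0.
have zN : z N.+1 = b by rewrite /z mulrC divfK ?pnatr_eq0// subrKC.
have zb k : (k <= N.+1)%N -> z k <= b.
  by move=> kN; rewrite -zN lerD2l ler_wpM2r// ler_nat.
apply/bounded_variationP => //; rewrite ge0_fin_numE ?total_variation_ge0//.
suff H k : (k <= N.+1)%N -> (total_variation a (z k) f <= k%:R%:E)%E.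
  by rewrite -zN (le_lt_trans (H _ (leqnn _)))// ltry.
elim: k => [_|k ih kN]; first by rewrite /z mul0r addr0 total_variationxx.
have zkS : z k <= z k.+1 by rewrite zS lerDl.
rewrite (total_variationD f (az k) zkS) -natr1 EFinD leeD ?ih ?(ltnW kN)//.
by apply: Hd => //; [exact: zb|rewrite zS addrC addKr].
Qed.

(** The final bound is weak because it has to survive a supremum over partitions, when passing from
    [f] to its total variation. *)
Definition seq_absolutely_continuous a b f := forall e, 0 < e ->
  exists2 d, 0 < d &
    forall s, nonoverlapping a b s -> total_length s < d -> jumps f s <= e.

(** Take for g(x) the total variation of f on [a, x], and h = g - f. The inequality |f y - f x| <= g
    y - g x makes both nondecreasing, and g inherits absolute continuity because
    [total_variation_jumps_le] bounds sums of variations, not only of jumps. *)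
Lemma absolutely_continuous_jordan a b f : a <= b ->
    absolutely_continuous a b f ->
  exists g h, [/\ {in `[a, b] &, {homo g : x y / x <= y}},
    {in `[a, b] &, {homo h : x y / x <= y}},
    seq_absolutely_continuous a b g,
    seq_absolutely_continuous a b h &
    {in `[a, b], f =1 g \- h}].
Proof.
move=> ab acf; have := absolutely_continuous_seq acf.
have BVf : bounded_variation a b f.
  have [d d0 Hd] := absolutely_continuous_seq acf ltr01.
  (* Absolute continuity at tolerance 1, on a single interval shorter than [d]. *)
  apply: (small_total_variation_bounded ab d0) => x y ax xy yb xyd.
  have := @total_variation_jumps_le a b f d 1 _ [:: (x, y)] [::].
  rewrite /jumps big_nil big_seq1 adde0; apply.
  - by move=> s abs sd; exact/ltW/Hd.
  - by rewrite /nonoverlapping/= /subitv/= ax xy yb.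
  - by rewrite /total_length big_seq1.
move=> acs.
pose T x := fine (total_variation a x f).
have TVfin x y : a <= x -> x <= y -> y <= b -> total_variation x y f \is a fin_num.
  move=> ax xy yb; apply/bounded_variationP => //.
  exact: bounded_variationr ax xy (bounded_variationl (le_trans ax xy) yb BVf).
have TB x y : a <= x -> x <= y -> y <= b ->
    T y - T x = fine (total_variation x y f).
  move=> ax xy yb; rewrite /T (total_variationD f ax xy) fineD ?TVfin//.
    by rewrite addrC addKr.
  exact: le_trans yb.
have TB_ge x y : a <= x -> x <= y -> y <= b -> `|f y - f x| <= T y - T x.
  move=> ax xy yb; rewrite TB// -lee_fin fineK ?TVfin//.
  exact: total_variation_ge.
have acT : seq_absolutely_continuous a b T.
  move=> e /acs[d d0 Hd]; exists d => // s abs sd.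
  have := @total_variation_jumps_le a b f d e _ s [::].
  rewrite cats0 /jumps big_nil adde0 -lee_fin -sumEFin => /(_ _ abs sd).
  move=> H; apply: le_trans (H _) => [|s' abs' sd']; last exact/ltW/Hd.
  rewrite [leLHS]big_seq [leRHS]big_seq lee_sum// => p ps.
  have /and3P[ap p12 pb] : subitv a b p by case/andP: abs => /allP/(_ _ ps).
  rewrite TB// ger0_norm ?fine_ge0 ?total_variation_ge0// fineK//.
  exact: TVfin.
exists T, (T \- f); split=> //.
- move=> x y; rewrite !in_itv/= => /andP[ax _] /andP[_ yb] xy.
  by rewrite -subr_ge0 (le_trans _ (TB_ge _ _ _ _ _)).
- move=> x y; rewrite !in_itv/= => /andP[ax _] /andP[_ yb] xy.
  have := TB_ge x y ax xy yb; have := ler_norm (f y - f x); rewrite /=; lra.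
- move=> e e0; have e20 : 0 < e / 2 by rewrite divr_gt0.
  have [d1 d10 H1] := acT _ e20; have [d2 d20 H2] := acs _ e20.
  exists (Num.min d1 d2); first by rewrite lt_min d10.
  move=> s abs; rewrite lt_min => /andP[/(H1 _ abs) l1 /(H2 _ abs) /ltW l2].
  rewrite [e]splitr; apply: le_trans (lerD l1 l2).
  rewrite /jumps -big_split ler_sum//= => p _.
  rewrite (le_trans _ (ler_normB _ _))// le_eqVlt; apply/orP; left; apply/eqP.
  by congr `|_|; ring.
- by move=> x _ /=; ring.
Qed.

End jordan_decomposition.

(** * Densities of absolutely continuous functions *)

Section stieltjes_density.
Variable R : realType.
Implicit Types (a b d e x y u v : R) (F f : R -> R) (A I : set R).

Local Notation mu := (@lebesgue_measure R).

(** The nearest-point projection onto [a, b]. Composing with it extends a function constantly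
    outside [a, b], so that continuity and monotonicity hold on the whole line. *)
Definition clamp a b x := Num.max a (Num.min b x).

Lemma clamp_in a b x : a <= b -> clamp a b x \in `[a, b].
Proof. by move=> ab; rewrite in_itv/= /clamp le_max lexx/= ge_max ab ge_min lexx. Qed.

Lemma clamp_id a b x : x \in `[a, b] -> clamp a b x = x.
Proof. by rewrite in_itv/= /clamp => /andP[ax xb]; rewrite (min_r xb) max_r. Qed.

Lemma clamp_homo a b x y : x <= y -> clamp a b x <= clamp a b y.
Proof.
move=> xy; rewrite /clamp ge_max !le_max lexx/= le_min !ge_min lexx xy.
by rewrite !orbT.
Qed.

Lemma clamp_contract a b x y : a <= b ->
  x <= y -> clamp a b y - clamp a b x <= y - x.
Proof.
move=> ab xy; rewrite /clamp.
case: (leP b x) => bx; case: (leP b y) => yb; rewrite ?(max_r ab) ?subrr ?subr_ge0//.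
- by lra.
- by case: (leP a x) => ax; lra.
- by case: (leP a x) => ax; case: (leP a y) => ay; lra.
Qed.

(** When nonempty, the set runs from its infimum to its supremum. Applied below to the components of
    a bounded open set. *)
Lemma bounded_open_interval u v I : open I -> is_interval I ->
    I `<=` `]u, v[%classic ->
  exists l r, [/\ u <= l, l <= r & I = `]l, r[%classic].
Proof.
move=> oI iI Iuv; have [->|/set0P[z Iz]] := eqVneq I set0.
  by exists u, u; split => //; rewrite set_itvoo0.
have lbI : has_lbound I.
  by exists u => x /Iuv /=; rewrite in_itv/= => /andP[/ltW].
have ubI : has_ubound I.
  by exists v => x /Iuv /=; rewrite in_itv/= => /andP[_ /ltW].
exists (inf I), (sup I); split.
- apply: lb_le_inf; first by exists z.
  by move=> x /Iuv /=; rewrite in_itv/= => /andP[/ltW].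
- by apply: (@le_trans _ _ z); [exact: ge_inf|exact: ub_le_sup].
- by rewrite -[LHS](iffLR (@interior_id _ I))// interval_bounded_interior.
Qed.

(** Otherwise the midpoint of the overlap is a common point. Strictness matters: an empty interval
    is disjoint from everything. *)
Lemma disjoint_oo_le u v x y : u < v -> x < y ->
  `]u, v[%classic `&` `]x, y[%classic = set0 -> (v <= x) || (y <= u).
Proof.
move=> uv xy uvxy; rewrite !leNgt -negb_and; apply/negP => /andP[xv uy].
have [w wl wr] : exists2 w, Num.max u x < w & w < Num.min v y.
  exists ((Num.max u x + Num.min v y) / 2);
    by rewrite midf_lt// lt_min !gt_max uv xv uy xy.
have : (`]u, v[%classic `&` `]x, y[%classic) w.
  move: wl wr; rewrite gt_max lt_min => /andP[uw xw] /andP[wv wy].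
  by split; rewrite /= in_itv/= ?uw ?xw.
by rewrite uvxy.
Qed.

(** [clamp] is 1-Lipschitz, and families of a single interval turn absolute continuity into uniform
    continuity. *)
Lemma clamp_continuous a b F : a <= b -> seq_absolutely_continuous a b F ->
  continuous (F \o clamp a b).
Proof.
move=> ab acF x; apply/cvgrPdist_le => e e0; have [d d0 Hd] := acF _ e0.
have H y z : y <= z -> z - y < d ->
    `|F (clamp a b z) - F (clamp a b y)| <= e.
  move=> yz zyd; have := Hd [:: (clamp a b y, clamp a b z)].
  rewrite /jumps /total_length !big_seq1/=; apply.
    rewrite /nonoverlapping/= /subitv/= clamp_homo// !andbT.
    have := clamp_in y ab; have := clamp_in z ab.
    by rewrite !in_itv/= => /andP[_ ->] /andP[->].
  exact: le_lt_trans (clamp_contract ab yz) zyd.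
near=> t.
have : `|x - t| < d by near: t; exact: cvgr_dist_lt.
have [xt|tx] := leP x t.
- by rewrite distrC ger0_norm ?subr_ge0// => td; rewrite distrC; exact: H.
- by rewrite ger0_norm ?subr_ge0 ?(ltW tx)// => td; apply: H => //; exact: ltW.
Unshelve. all: by end_near. Qed.

Lemma stieltjes_itv (F : cumulative R R) x y : x <= y ->
  lebesgue_stieltjes_measure F `]x, y]%classic = (F y - F x)%:E.
Proof.
move=> xy; rewrite /lebesgue_stieltjes_measure /measure_extension/=.
rewrite measurable_mu_extE/=; last exact: is_ocitv.
by rewrite wlength_itv_bnd.
Qed.

Lemma stieltjes_oo_le (G : cumulative R R) x y : x <= y ->
  (lebesgue_stieltjes_measure G `]x, y[%classic <= (G y - G x)%:E)%E.
Proof.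
move=> xy; rewrite -stieltjes_itv//; apply: le_measure; rewrite ?inE//.
by apply: subset_itvl; rewrite bnd_simp.
Qed.

(** An open cover of the null set with Lebesgue measure below [d] is a countable disjoint union of
    intervals, and absolute continuity bounds by e the increments of F over every finite part of
    it. *)
Lemma stieltjes_null a b F (G : cumulative R R) A : a <= b ->
    {in `[a, b] &, {homo F : x y / x <= y}} ->
    seq_absolutely_continuous a b F -> G =1 F \o clamp a b ->
    A `<=` `]a, b]%classic -> measurable A -> mu A = 0%E ->
  lebesgue_stieltjes_measure G A = 0%E.
Proof.
move=> ab ndF acF GE Aab mA A0.
apply/eqP; rewrite eq_le measure_ge0 andbT; apply/lee_addgt0Pr => e e0.
rewrite add0e; have [d d0 Hd] := acF _ e0.
have [U [oU AU Ud]] : exists U : set R,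
    [/\ open U, A `<=` U & (mu (U `\` A) < d%:E)%E].
  have Aoo : (mu A < +oo)%E by rewrite A0 ltry.
  exact: lebesgue_regularity_outer.
(* Bounded, so that the components have real endpoints; the margin of 1 keeps the point b inside. *)
pose V := U `&` `]a - 1, b + 1[%classic.
have oV : open V by apply: openI => //; exact: interval_open.
have AV : A `<=` V.
  move=> x Ax; split; first exact: AU.
  by have := Aab _ Ax; rewrite /= !in_itv/= => /andP[ax xb]; apply/andP; split; lra.
have mV : measurable V by exact: open_measurable.
have Vd : (mu V < d%:E)%E.
  rewrite (le_lt_trans _ Ud)//; apply: (@le_trans _ _ (mu U)).
    by apply: le_measure; rewrite ?inE//; [exact: open_measurable|exact: subIsetl].
  have : (mu U <= mu (U `\` A) + mu A)%E.
    rewrite -[in leLHS](setDKU AU) measureU2//.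
    by apply: measurableD => //; exact: open_measurable.
  by rewrite A0 adde0.
have /choice[lr lrE] k : exists lr : R * R, [/\ a - 1 <= lr.1, lr.1 <= lr.2 &
    open_disjoint_itv oV k = `]lr.1, lr.2[%classic].
  have Ik : open_disjoint_itv oV k `<=` `]a - 1, b + 1[%classic.
    move=> x Ix; have : V x by rewrite (open_disjoint_itv_bigcup oV); exists k.
    by case.
  have [l [r lrP]] := bounded_open_interval (@open_disjoint_itv_open _ _ oV k)
    (@open_disjoint_itv_is_interval _ _ oV k) Ik.
  by exists (l, r).
pose J k : set R := `](lr k).1, (lr k).2[%classic.
have VJ : V = \bigcup_k J k.
  by rewrite (open_disjoint_itv_bigcup oV); apply: eq_bigcupr => k _; case: (lrE k).
have tJ : trivIset setT J.
  have := @open_disjoint_itv_trivIset R _ oV; congr trivIset; apply/funext => k.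
  by case: (lrE k).
have mJ k : measurable (J k) by exact: measurable_itv.
pose c := clamp a b.
apply: (@le_trans _ _ (lebesgue_stieltjes_measure G V)).
  by apply: le_measure; rewrite ?inE.
rewrite {1}VJ measure_bigcup//; last by move=> k _; exact: mJ.
(* By countable additivity the measure is a limit of partial sums, and it suffices to bound each of
   them. *)
apply: lime_le.
  by apply: is_cvg_nneseries => k _ _; exact: measure_ge0.
apply: nearW => n.
(* Endpoints are clamped because F is controlled only on [a, b]. Empty intervals are dropped: they
   carry no mass and need not be [apart] from the others. *)
pose s := [seq (c (lr k).1, c (lr k).2) | k <- iota 0 n & (lr k).1 < (lr k).2].
have abs : nonoverlapping a b s.
  apply/andP; split.
    apply/allP => _ /mapP[k _ ->]; rewrite /subitv/=.
    have := clamp_in (lr k).1 ab; have := clamp_in (lr k).2 ab.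
    rewrite !in_itv/= => /andP[_ ->] /andP[-> _]/=; rewrite andbT.
    by apply: clamp_homo; case: (lrE k).
  rewrite pairwise_map; apply: (@sub_in_pairwise _ (fun k => (lr k).1 < (lr k).2) ltn).
  - move=> i j lri lrj ij /=.
    have : J i `&` J j = set0.
      by move/trivIsetP : tJ; apply => //; rewrite ltn_eqF.
    by move=> /(disjoint_oo_le lri lrj)/orP[] h; apply/orP; [left|right];
      exact: clamp_homo.
  - exact: filter_all.
  - by rewrite -sorted_pairwise ?sorted_filter ?iota_ltn_sorted//; exact: ltn_trans.
have sd : total_length s < d.
  rewrite -lte_fin (le_lt_trans _ Vd)//.
  apply: (@le_trans _ _ (mu (\big[setU/set0]_(k < n) J k))).
    rewrite measure_bigsetU// /total_length big_map big_filter big_mkcond/=.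
    rewrite -sumEFin -(big_mkord xpredT (mu \o J)) /index_iota subn0 lee_sum// => k _.
    rewrite /J /= lebesgue_measure_itv/= lte_fin; case: ifPn => // _.
    rewrite -EFinB lee_fin clamp_contract//.
    by have [_ lrk _] := lrE k; exact: lrk.
  have mUJ : measurable (\big[setU/set0]_(k < n) J k) by exact: bigsetU_measurable.
  apply: le_measure; rewrite ?inE//.
  by rewrite VJ; exact: bigsetU_bigcup.
apply: (@le_trans _ _ (jumps F s)%:E); last by rewrite lee_fin; exact: Hd.
rewrite /jumps big_map big_filter -sumEFin [leRHS]big_mkcond/=.
rewrite /index_iota subn0; under eq_bigl do rewrite in_setT.
apply: lee_sum => k _; case: ifPn => [lrk|].
  have cc : c (lr k).1 <= c (lr k).2 by rewrite clamp_homo// ltW.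
  rewrite ger0_norm; last by rewrite subr_ge0 ndF// clamp_in.
  by rewrite (le_trans (stieltjes_oo_le _ (ltW lrk)))// !GE.
by rewrite -leNgt => lrk; rewrite /J set_itv_ge ?measure0// bnd_simp -leNgt.
Qed.

(** The density is the Radon-Nikodym derivative of the Stieltjes measure of the clamped function;
    domination by Lebesgue measure is [stieltjes_null]. *)
Lemma nondecreasing_density a b F : a <= b ->
    {in `[a, b] &, {homo F : x y / x <= y}} ->
    seq_absolutely_continuous a b F ->
  exists2 g : R -> R, mu.-integrable setT (EFin \o g) &
    {in `[a, b], forall x, F x - F a = \int[mu]_(t in `]a, x]) g t}.
Proof.
move=> ab ndF acF.
have ndG : nondecreasing (F \o clamp a b).
  by move=> x y xy /=; rewrite ndF ?clamp_in// clamp_homo.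
have rcG : right_continuous (F \o clamp a b).
  by apply: right_continuousW; exact: clamp_continuous.
pose G : cumulative R R := HB.pack (F \o clamp a b)
  (isCumulative.Build R _ R (F \o clamp a b) ndG rcG).
pose nu := lebesgue_stieltjes_measure G.
have mab : measurable (`]a, b]%classic : set (measurableTypeR R)).
  exact: measurable_itv.
have nuab : (nu `]a, b]%classic < +oo)%E by rewrite /nu stieltjes_itv// ltry.
(* Restricting to ]a, b] gives a finite measure and places the null sets where [stieltjes_null]
   applies. *)
pose nuD := mfrestr mab nuab.
have nuDmu : nuD `<< mu.
  apply/null_content_dominatesP => A mA A0.
  rewrite /nuD /mfrestr /mrestr.
  have mAab : measurable (A `&` `]a, b]%classic) by exact: measurableI.
  apply: (stieltjes_null ab ndF acF _ _ mAab) => //.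
  apply/eqP; rewrite eq_le measure_ge0 andbT -[leRHS]A0.
  by apply: le_measure; rewrite ?inE.
have [g [g0 gfin ig nug]] := radon_nikodym_sigma_finite nuDmu.
have gE : EFin \o (fine \o g) = g by apply/funext => x /=; rewrite fineK.
exists (fine \o g); first by rewrite gE.
move=> x; rewrite in_itv/= => /andP[ax xb].
have nux : nuD `]a, x]%classic = (F x - F a)%:E.
  rewrite /nuD /mfrestr /mrestr setIidl; last first.
    by apply: subset_itvl; rewrite bnd_simp.
  transitivity (G x - G a)%:E; first exact: stieltjes_itv.
  by rewrite /G/= !clamp_id// in_itv/= ?ax ?xb ?lexx.
have mx : measurable (`]a, x]%classic : set (measurableTypeR R)).
  exact: measurable_itv.
have intx : (\int[mu]_(t in `]a, x]) g t = (F x - F a)%:E)%E.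
  exact: eq_trans (esym (nug _ mx)) nux.
rewrite /Rintegral.
by rewrite -[RHS]/(fine (\int[mu]_(t in `]a, x]) (EFin \o (fine \o g)) t)%E) gE intx.
Qed.

Lemma absolutely_continuous_density a b f : a <= b ->
    absolutely_continuous a b f ->
  exists2 g : R -> R, mu.-integrable setT (EFin \o g) &
    {in `[a, b], forall x, f x - f a = \int[mu]_(t in `]a, x]) g t}.
Proof.
move=> ab /(absolutely_continuous_jordan ab)[p [q [ndp ndq acp acq fpq]]].
have [gp igp pE] := nondecreasing_density ab ndp acp.
have [gq igq qE] := nondecreasing_density ab ndq acq.
exists (gp \- gq).
  have -> : EFin \o (gp \- gq) = ((EFin \o gp) \- (EFin \o gq))%E.
    by apply/funext => t.
  exact: integrableB.
move=> x xab; rewrite RintegralB//; last 2 first.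
  by apply: integrableS igp.
  by apply: integrableS igq.
rewrite -pE// -qE// !fpq ?in_itv/= ?lexx//; ring.
Qed.

(** Lebesgue's differentiation theorem for the primitive of g, from which f differs by a constant
    near every interior point. At a and b the derivative would involve values of f outside
    [a, b]. *)
Lemma derivable_of_density a b f (g : R -> R) :
    mu.-integrable setT (EFin \o g) ->
    {in `[a, b], forall x, f x - f a = \int[mu]_(t in `]a, x]) g t} ->
  {ae mu, forall x, x \in `]a, b[ -> derivable f x 1 /\ derive1 f x = g x}.
Proof.
move=> ig fg.
have mg : measurable_fun setT g by have /measurable_int/measurable_EFinP := ig.
have lg : locally_integrable setT g.
  by apply: open_integrable_locally => //; exact: openT.
have := @FTC1 R g (BRight a) _ lg; case.
  by move=> y; apply: integrableS ig.
move=> N [mN N0 HN]; exists N; split => // x /= Hx; apply: HN => /= H; apply: Hx.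
rewrite in_itv/= => /andP[ax xb].
have [] := H _; first by rewrite lte_fin.
set G := (X in derivable X) => dG <-.
have Gf : {near x, G \+ cst (f a) =1 f}.
  near=> t; rewrite /G /= -fg ?subrK// in_itv/=; apply/andP; split.
  - by near: t; exact: lt_le_nbhsr.
  - by near: t; exact: lt_le_nbhsl.
have dG' : derivable (G \+ cst (f a)) x 1 by exact: derivableD.
split.
- exact: near_eq_derivable dG'.
- by rewrite !derive1E -(near_eq_derive _ Gf) deriveD// derive_cst addr0.
Unshelve. all: by end_near. Qed.

End stieltjes_density.

(** * The fundamental theorem of calculus *)

Section measurable_derive1.
Variable R : realType.
Implicit Types (f : R -> R) (h t : R).

Let invS_lt (e : R) : 0 < e -> exists n : nat, n.+1%:R^-1 < e.
Proof.
move=> e0; exists (Num.bound e^-1); rewrite invf_plt ?posrE ?ltr0n//.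
by rewrite (lt_trans (archi_boundP _)) ?ltr_nat// invr_ge0 ltW.
Qed.

Let quotient f h t := h^-1 *: ((f \o shift t) (h *: 1) - f t).

(* Arbitrary intersections of closed sets are closed, so that [h] and [h'] may
   range over all real numbers in Cauchy's criterion. *)
Let derivable_set f : [set t | derivable f t 1] =
  \bigcap_k \bigcup_m \bigcap_(hh in [set hh : R * R |
     [/\ hh.1 != 0, hh.2 != 0, `|hh.1| < m.+1%:R^-1 & `|hh.2| < m.+1%:R^-1]])
   [set t | `|quotient f hh.1 t - quotient f hh.2 t| <= k.+1%:R^-1].
Proof.
apply/seteqP; split => t /=.
- move=> /cvg_ex[l /= ql] k _.
  (* Half of the tolerance, since two quotients are compared through their limit. *)
  have k0 : 0 < k.+1%:R^-1 / 2 :> R by rewrite divr_gt0// invr_gt0 ltr0n.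
  have /cvgrPdist_lt/(_ _ k0)[d /= d0 Hd] := ql.
  have [m md] := invS_lt d0.
  exists m => // -[h1 h2] /= [h10 h20 h1m h2m].
  have := Hd h1; rewrite /= sub0r normrN => /(_ (lt_trans h1m md) h10) H1.
  have := Hd h2; rewrite /= sub0r normrN => /(_ (lt_trans h2m md) h20) H2.
  rewrite ltW// [ltRHS]splitr.
  by rewrite (le_lt_trans (ler_distD l _ _))// ltrD// distrC.
- move=> Ht; apply/cauchy_cvgP/cauchy_ballP => e e0.
  have [k ke] := invS_lt e0.
  have [m _ Hm] := Ht k I.
  (* A set of diameter at most 1 / (k + 1) containing all quotients with small increment: it
     witnesses the Cauchy property. *)
  pose A : set R := [set quotient f h t | h in
    [set h | h != 0 /\ `|h| < m.+1%:R^-1]].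
  exists (A, A) => /=.
    by split; exists m.+1%:R^-1; rewrite /= ?invr_gt0 ?ltr0n// => h /=;
      rewrite sub0r normrN => hm h0; exists h.
  move=> [_ _] /= [[h1 [h10 h1m] <-] [h2 [h20 h2m] <-]].
  by apply: le_lt_trans ke; exact: (Hm (h1, h2)).
Qed.

Let quotient_continuous f h : continuous f -> continuous (quotient f h).
Proof.
move=> cf t; apply: cvgZr; apply: cvgB; last exact: cf.
apply: (@continuous_comp _ _ _ (fun t => h *: 1 + t) f); last exact: cf.
by apply: cvgD; [exact: cvg_cst|exact: cvg_id].
Qed.

Let measurable_derivable f : continuous f ->
  measurable [set t | derivable f t 1].
Proof.
move=> cf; rewrite derivable_set; apply: bigcapT_measurable => k.
apply: bigcupT_measurable => m.
apply: closed_measurable; apply: closed_bigI => -[h1 h2] _.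
apply: (@preimage_closed _ _ (fun t => `|quotient f h1 t - quotient f h2 t|)
  [set x | x <= _]); last exact: closed_le.
by move=> t _; apply: cvg_norm; apply: cvgB; exact: quotient_continuous.
Qed.

(** On the measurable set of derivability, the derivative is the pointwise limit of the quotients
    with increment 1 / (n + 1), each of them continuous. *)
Lemma measurable_derive1 f : continuous f -> measurable_fun setT (derive1 f).
Proof.
move=> cf; pose D := [set t | derivable f t 1].
have mD : measurable D by exact: measurable_derivable.
rewrite -(setUv D); apply/measurable_funU => //; first exact: measurableC.
split.
- apply: (@measurable_fun_cvg _ _ _ _ (fun n => quotient f n.+1%:R^-1)).
    move=> n; apply: measurable_funTS; apply: continuous_measurable_fun.
    exact: quotient_continuous.
  move=> t dt; rewrite derive1E.
  move/cvgr_dnbhsP : dt; apply; split; first by move=> n; rewrite invr_neq0.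
  exact: cvg_harmonic.
(* Off that set the quotients diverge and [derive1 f] takes the constant default value [point]. *)
- apply: (@eq_measurable_fun _ _ _ _ _ (cst point)) => //.
  by move=> t; rewrite inE => dt; rewrite derive1E; exact/esym/dvgP.
Qed.

End measurable_derive1.

Section fundamental_theorem.
Variable R : realType.
Implicit Types (a b x y : R) (f g u v : R -> R).

Local Notation mu := (@lebesgue_measure R).

Lemma ae_neq a : {ae mu, forall x, x != a}.
Proof.
exists [set a]; split; first exact: measurable_set1.
  exact: lebesgue_measure_set1.
by move=> x /= /negP; rewrite negbK => /eqP.
Qed.

Lemma ae_itv_oo_cc a b (P : R -> Prop) :
    {ae mu, forall x, x \in `]a, b[ -> P x} ->
  {ae mu, forall x, `[a, b]%classic x -> P x}.
Proof.
have aef := @ae_filter_ringOfSetsType _ _ _ mu.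
apply: filterS3 (ae_neq a) (ae_neq b) => x xa xb Px.
rewrite /= in_itv/= => /andP[ax bx]; apply: Px.
by rewrite in_itv/= !lt_neqAle eq_sym xa xb ax bx.
Qed.

(** For signed integrands: v - u agrees almost everywhere with its absolute value, so its integral
    is nonnegative. *)
Lemma ae_le_integral D u v : measurable D ->
    mu.-integrable D (EFin \o u) -> mu.-integrable D (EFin \o v) ->
    {ae mu, forall x, D x -> u x <= v x} ->
  (\int[mu]_(x in D) (u x)%:E <= \int[mu]_(x in D) (v x)%:E)%E.
Proof.
move=> mD iu iv uv.
have iuv := integrableB mD iv iu.
rewrite -sube_ge0; last by rewrite integrable_fin_num.
rewrite -integralB//.
rewrite (_ : (\int[mu]_(x in D) _)%E =
    (\int[mu]_(x in D) `|((EFin \o v) \- (EFin \o u)) x|)%E); last first.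
  apply: ae_eq_integral => //.
  - exact: measurable_int iuv.
  - by apply: measurableT_comp => //; exact: measurable_int iuv.
  - have aef := @ae_filter_ringOfSetsType _ _ _ mu.
    apply: filterS uv => x uvx Dx /=.
    by rewrite ger0_norm// subr_ge0 uvx.
exact: integral_ge0.
Qed.

Lemma derive1_clamp a b f x : x \in `]a, b[ ->
  derive1 (f \o clamp a b) x = derive1 f x.
Proof.
rewrite in_itv/= => /andP[ax xb]; rewrite !derive1E; apply: near_eq_derive.
near=> t => /=; rewrite clamp_id// in_itv/=; apply/andP; split.
- by near: t; exact: lt_le_nbhsr.
- by near: t; exact: lt_le_nbhsl.
Unshelve. all: by end_near. Qed.

Lemma absolutely_continuous_clamp a b f : a <= b ->
  absolutely_continuous a b f -> continuous (f \o clamp a b).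
Proof.
move=> ab acf; apply: clamp_continuous => // e e0.
have [d d0 Hd] := absolutely_continuous_seq acf e0.
by exists d => // s abs sd; exact/ltW/Hd.
Qed.

Lemma absolutely_continuous_measurable a b f : a <= b ->
  absolutely_continuous a b f -> measurable_fun `[a, b] f.
Proof.
move=> ab acf; apply: (@eq_measurable_fun _ _ _ _ _ (f \o clamp a b)).
  by move=> x; rewrite inE/= => xab; rewrite clamp_id.
apply: measurable_funTS; apply: continuous_measurable_fun.
exact: absolutely_continuous_clamp.
Qed.

(** The continuous extension of [f] through [clamp] has the same derivative inside the interval, and
    the two endpoints do not affect measurability. *)
Lemma absolutely_continuous_measurable_derive1 a b f : a <= b ->
  absolutely_continuous a b f -> measurable_fun `[a, b] (derive1 f).
Proof.
move=> ab acf; apply: (@measurable_fun_itv_cc _ _ _ false true).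
apply: (@eq_measurable_fun _ _ _ _ _ (derive1 (f \o clamp a b))).
  by move=> x; rewrite inE/= => xab; rewrite derive1_clamp.
apply: measurable_funTS; apply: measurable_derive1.
exact: absolutely_continuous_clamp.
Qed.

Lemma absolutely_continuous_ae_derivable a b f : a <= b ->
  absolutely_continuous a b f ->
  {ae mu, forall x, x \in `]a, b[ -> derivable f x 1}.
Proof.
move=> ab acf; have [g ig fg] := absolutely_continuous_density ab acf.
have aef := @ae_filter_ringOfSetsType _ _ _ mu.
by apply: filterS (derivable_of_density ig fg) => x H /H[].
Qed.

(** The derivative equals the density almost everywhere, hence has its integrability and its
    integral. *)
Lemma absolutely_continuous_FTC a b f : a <= b ->
    absolutely_continuous a b f ->
  mu.-integrable `[a, b] (EFin \o derive1 f) /\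
  (\int[mu]_(t in `[a, b]) (derive1 f t)%:E = (f b - f a)%:E)%E.
Proof.
move=> ab acf; have [g ig fg] := absolutely_continuous_density ab acf.
have igab : mu.-integrable `[a, b] (EFin \o g) by apply: integrableS ig.
have fgae : {ae mu, forall x, `[a, b]%classic x -> derive1 f x = g x}.
  apply: ae_itv_oo_cc; have aef := @ae_filter_ringOfSetsType _ _ _ mu.
  by apply: filterS (derivable_of_density ig fg) => x H /H[].
have mf : measurable_fun `[a, b] (EFin \o derive1 f).
  by apply/measurable_EFinP; exact: absolutely_continuous_measurable_derive1.
have aef := @ae_filter_ringOfSetsType _ _ _ mu.
have intE : (\int[mu]_(t in `[a, b]) (derive1 f t)%:E =
    \int[mu]_(t in `[a, b]) (g t)%:E)%E.
  apply: ae_eq_integral => //; first exact: measurable_int igab.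
  by apply: filterS fgae => x H /H /= ->.
split.
- apply/integrableP; split => //.
  have /integrableP[mg] := igab; congr (_ < _)%E.
  apply: ae_eq_integral => //; try exact: measurableT_comp.
  by apply: filterS fgae => x H /H /= ->.
- rewrite intE fg ?in_itv/= ?ab ?lexx// Rintegral_itv_obnd_cbnd; last first.
    by apply: integrableS ig.
  by rewrite /Rintegral fineK// integrable_fin_num.
Qed.

End fundamental_theorem.

(** * Closure properties of absolute continuity, and square integrability *)

Section absolutely_continuous_functions.
Variable R : realType.
Implicit Types (a b x y K M : R) (f g h df : R -> R).

Local Notation mu := (@lebesgue_measure R).

(** The common source of the closure properties below: increments of f are controlled by those of g
    and h. *)
Lemma absolutely_continuous_le a b f g h K : 0 <= K ->
    {in `[a, b] &, forall x y,
      `|f y - f x| <= K * (`|g y - g x| + `|h y - h x|)} ->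
    absolutely_continuous a b g -> absolutely_continuous a b h ->
  absolutely_continuous a b f.
Proof.
move=> K0 fgh acg ach e e0.
(* K + 1 instead of K, so as to divide by it also when K = 0. *)
have K1 : 0 < K + 1 by rewrite ltr_wpDl.
have e'0 : 0 < e / (K + 1) / 2 by rewrite !divr_gt0.
have [d1 d10 H1] := acg _ e'0; have [d2 d20 H2] := ach _ e'0.
exists (Num.min d1 d2); first by rewrite lt_min d10.
move=> n l r lr tlr; rewrite lt_min => /andP[lr1 lr2].
have := ltrD (H1 _ _ _ lr tlr lr1) (H2 _ _ _ lr tlr lr2).
rewrite -splitr -big_split/= ltr_pdivlMr// mulrC => Hlt.
apply: le_lt_trans Hlt; rewrite mulr_sumr ler_sum// => i _.
have [al lr' rb] := lr i.
have lab : l i \in `[a, b] by rewrite in_itv/= al (le_trans lr').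
have rab : r i \in `[a, b] by rewrite in_itv/= rb (le_trans al).
by rewrite (le_trans (fgh _ _ lab rab))// ler_wpM2r ?addr_ge0// lerDl.
Qed.

Lemma absolutely_continuous_id a b : absolutely_continuous a b id.
Proof.
move=> e e0; exists e => // n l r lr _ lre.
rewrite (le_lt_trans _ lre)// ler_sum// => i _.
by have [_ lri _] := lr i; rewrite ger0_norm// subr_ge0.
Qed.

Lemma lipschitz_absolutely_continuous a b f K : 0 <= K ->
    {in `[a, b] &, forall x y, `|f y - f x| <= K * `|y - x|} ->
  absolutely_continuous a b f.
Proof.
move=> K0 fK; apply: (@absolutely_continuous_le _ _ _ id id K) => //.
- move=> x y xab yab; rewrite (le_trans (fK _ _ xab yab))// ler_wpM2l//.
  by rewrite lerDl.
- exact: absolutely_continuous_id.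
- exact: absolutely_continuous_id.
Qed.

Lemma bounded_derivative_lipschitz a b f df K :
    {in `[a, b], forall x, is_derive x 1 f (df x)} ->
    {in `[a, b], forall x, `|df x| <= K} ->
  {in `[a, b] &, forall x y, `|f y - f x| <= K * `|y - x|}.
Proof.
move=> fdf dfK x y; wlog xy : x y / x <= y => [hw xab yab|xab yab].
  have [/hw|/ltW/hw] := leP x y; first exact.
  by rewrite distrC (distrC y); exact.
have sub z : z \in `[x, y] -> z \in `[a, b].
  move: xab yab; rewrite !in_itv/= => /andP[ax _] /andP[_ yb] /andP[xz zy].
  by rewrite (le_trans ax) ?(le_trans zy).
have sub' z : z \in `]x, y[ -> z \in `[a, b].
  by rewrite in_itv/= => /andP[xz zy]; apply: sub; rewrite in_itv/= !ltW.
have [z zxy ->] : exists2 c, c \in `[x, y] & f y - f x = df c * (y - x).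
  apply: MVT_segment => //; first by move=> z /sub'/fdf.
  apply: derivable_within_continuous => z /sub/fdf dz.
  exact: ex_derive.
by rewrite normrM ler_wpM2r// dfK// sub.
Qed.

(** The extreme value theorem is applied to the extension through [clamp], since f as a function on
    the line may be discontinuous at a and b. *)
Lemma absolutely_continuous_bounded a b f : a <= b ->
    absolutely_continuous a b f ->
  exists2 M, 0 <= M & {in `[a, b], forall x, `|f x| <= M}.
Proof.
move=> ab acf.
have [|c cab Hc] := @EVT_max _ (fun x => `|(f \o clamp a b) x|) _ _ ab.
  apply: continuous_subspaceT => x; apply: cvg_norm.
  exact: absolutely_continuous_clamp.
exists `|(f \o clamp a b) c| => // x xab.
by have := Hc _ xab; rewrite /= (clamp_id xab).
Qed.

(** By compactness the values stay away from 0, near which the logarithm is not Lipschitz. *)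
Lemma absolutely_continuous_pos a b f : a <= b ->
    absolutely_continuous a b f -> {in `[a, b], forall x, 0 < f x} ->
  exists2 m, 0 < m & {in `[a, b], forall x, m <= f x}.
Proof.
move=> ab acf f0.
have [|c cab Hc] := @EVT_min _ (f \o clamp a b) _ _ ab.
  by apply: continuous_subspaceT; exact: absolutely_continuous_clamp.
exists (f c); first exact: f0.
by move=> x xab; have := Hc _ xab; rewrite /= !clamp_id.
Qed.

Lemma absolutely_continuousB a b f g : absolutely_continuous a b f ->
  absolutely_continuous a b g -> absolutely_continuous a b (f \- g).
Proof.
move=> acf acg; apply: (@absolutely_continuous_le _ _ _ f g 1) => // x y _ _ /=.
rewrite mul1r (le_trans _ (ler_normB _ _))// le_eqVlt; apply/orP; left.
by apply/eqP; congr `|_|; ring.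
Qed.

Lemma absolutely_continuousM a b f g : a <= b -> absolutely_continuous a b f ->
  absolutely_continuous a b g -> absolutely_continuous a b (f \* g).
Proof.
move=> ab acf acg.
have [M1 M10 fM] := absolutely_continuous_bounded ab acf.
have [M2 M20 gM] := absolutely_continuous_bounded ab acg.
apply: (@absolutely_continuous_le _ _ _ f g (M1 + M2)) => //.
  exact: addr_ge0.
move=> x y xab yab /=.
have -> : f y * g y - f x * g x = (f y - f x) * g y + f x * (g y - g x) by ring.
rewrite (le_trans (ler_normD _ _))// !normrM mulrDr lerD//.
- by rewrite mulrC ler_wpM2r// (le_trans (gM _ yab))// lerDr.
- by rewrite ler_wpM2r// (le_trans (fM _ xab))// lerDl.
Qed.

(** The values of f lie in some [m, M] with m > 0, where the derivative 1 / x of ln is at most 1 /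
    m. *)
Lemma absolutely_continuous_ln a b f : a <= b -> absolutely_continuous a b f ->
    {in `[a, b], forall x, 0 < f x} ->
  absolutely_continuous a b (fun x => ln (f x)).
Proof.
move=> ab acf /(absolutely_continuous_pos ab acf)[m m0 mf].
have [M M0 fM] := absolutely_continuous_bounded ab acf.
apply: (@absolutely_continuous_le _ _ _ f f m^-1) => //.
  by rewrite invr_ge0 ltW.
move=> x y xab yab; apply: (@le_trans _ _ (m^-1 * `|f y - f x|)); last first.
  by rewrite ler_wpM2l ?invr_ge0 ?(ltW m0)// lerDl.
have H z : z \in `[m, M] -> 0 < z.
  by rewrite in_itv/= => /andP[mz _]; exact: lt_le_trans mz.
have fmM z : z \in `[a, b] -> f z \in `[m, M].
  by move=> zab; rewrite in_itv/= mf//= (le_trans (ler_norm _))// fM.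
apply: (@bounded_derivative_lipschitz m M _ GRing.inv); last 2 first.
- exact: fmM.
- exact: fmM.
- by move=> z /H z0; exact: is_derive1_ln.
- move=> z zmM; have z0 := H _ zmM; rewrite ger0_norm ?invr_ge0 ?(ltW z0)//.
  by rewrite lef_pV2 ?posrE//; move: zmM; rewrite in_itv/= => /andP[].
Qed.

Lemma expe2_poweR (x : \bar R) : (0 <= x)%E -> (x ^+ 2 = x `^ 2)%E.
Proof.
case: x => [r r0| _|//]; first by rewrite poweR_EFin powR_mulrn.
by rewrite poweRyr// expe2 mulyy.
Qed.

Lemma L2norm_sqr a b f :
  (L2norm a b f ^+ 2 = \int[mu]_(t in `[a, b]) (f t ^+ 2)%:E)%E.
Proof.
rewrite expe2_poweR ?Lnorm_ge0// /L2norm poweR_Lnorm// [RHS]integral_mkcond.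
apply: eq_integral => x _ /=; rewrite !patchE; case: ifPn => _.
- by rewrite powR_mulrn// -normrX ger0_norm ?sqr_ge0.
- by rewrite normr0 powR0.
Qed.

Lemma L2P a b f : L2 a b f <-> measurable_fun `[a, b] f /\
  (\int[mu]_(t in `[a, b]) (f t ^+ 2)%:E < +oo)%E.
Proof.
have mab : measurable (`[a, b]%classic : set R) by exact: measurable_itv.
rewrite -L2norm_sqr; split.
- move=> Lf; split.
    apply/(measurable_restrictT _ mab).
    by have := sub_Lfun_mfun Lf; rewrite inE.
  have Lfoo : (L2norm a b f < +oo)%E.
    by have := sub_Lfun_finLfun Lf; rewrite inE.
  by rewrite expe2_poweR ?Lnorm_ge0// poweR_lty.
- move=> [mf foo]; rewrite /L2 inE; apply/andP; split; rewrite inE.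
    exact/(measurable_restrictT _ mab).
  rewrite /= /finite_norm -/(L2norm a b f).
  rewrite ltNge leye_eq; apply/negP => /eqP Loo.
  by move: foo; rewrite Loo expe2 mulyy ltxx.
Qed.

Lemma L2_integrable_sqr a b f : L2 a b f ->
  mu.-integrable `[a, b] (EFin \o (fun t => f t ^+ 2)).
Proof.
move=> /L2P[mf foo]; apply/integrableP; split.
  by apply/measurable_EFinP; exact: measurable_funX.
by under eq_integral do rewrite /= ger0_norm ?sqr_ge0//.
Qed.

End absolutely_continuous_functions.

(** * Poincare's inequality *)

Section poincare.
Variable R : realType.
Implicit Types (a b c m t : R) (eta : R -> R).

Local Notation mu := (@lebesgue_measure R).

Lemma is_derive_affine c m t : is_derive t 1 (fun x => c * (x - m)) c.
Proof.
have dl : is_derive t 1 (id - cst m) (1 - 0) by exact: is_deriveB.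
by have := is_deriveZ c dl; rewrite subr0 /GRing.scale/= mulr1.
Qed.

Lemma lebesgue_measure_cc a b : a <= b ->
  mu `[a, b]%classic = (b - a)%:E.
Proof.
rewrite lebesgue_measure_itv/= lte_fin le_eqVlt => /predU1P[->|->//].
by rewrite ltxx subrr.
Qed.

Lemma integrable_sqr_absolutely_continuous a b eta : a <= b ->
    absolutely_continuous a b eta ->
  mu.-integrable `[a, b] (EFin \o (fun t => eta t ^+ 2)).
Proof.
move=> ab aceta; have [M M0 etaM] := absolutely_continuous_bounded ab aceta.
have muab : (mu `[a, b]%classic < +oo)%E by rewrite lebesgue_measure_cc// ltry.
apply: measurable_bounded_integrable => //.
- by apply: measurable_funX; exact: absolutely_continuous_measurable.
- exists (M ^+ 2); split; first exact: num_real.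
  move=> x Mx t /= tab; rewrite normrX (le_trans _ (ltW Mx))//.
  by rewrite lerXn2r ?nnegrE// etaM.
Qed.

(** [psi] is the logarithmic derivative of cos theta, a solution of u'' = - c^2 u. The bound on c
    keeps [theta], centred at the midpoint, strictly between - pi / 2 and pi / 2, so that [psi] has
    no pole on [a, b]. *)
Lemma poincare_subcritical a b c : a < b -> 0 < c -> c * (b - a) < pi ->
  poincare_inequality a b (c ^+ 2).
Proof.
move=> ab c0 cpi eta [aceta L2eta etaa etab].
pose m := (a + b) / 2; pose theta t := c * (t - m).
pose psi t := - (c * tan (theta t)).
pose dpsi t := - (c * ((cos (theta t)) ^- 2 * c)).
have thetaP t : t \in `[a, b] -> - (pi / 2) < theta t < pi / 2.
  rewrite in_itv/= /theta /m => /andP[at' tb].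
  by apply/andP; split; nra.
have cos_gt0 t : t \in `[a, b] -> 0 < cos (theta t).
  by move=> /thetaP; exact: cos_gt0_pihalf.
have dtheta t : is_derive t 1 theta c by exact: is_derive_affine.
(* A lower bound k on the cosine bounds |psi'| by c^2 / k^2, so that [psi] is Lipschitz. *)
have [k k0 coskP] : exists2 k, 0 < k & {in `[a, b], forall t, k <= cos (theta t)}.
  have [|t0 t0ab Ht0] := @EVT_min _ (cos \o theta) _ _ (ltW ab).
    apply: derivable_within_continuous => t _.
    by apply: ex_derive; apply: is_derive1_comp.
  by exists (cos (theta t0)) => //; exact: cos_gt0.
have dpsiP t : t \in `[a, b] -> is_derive t 1 psi (dpsi t).
  move=> tab; have ct : cos (theta t) != 0 by rewrite gt_eqF// cos_gt0.
  have dtan := is_derive1_comp (is_derive_tan ct) (dtheta t).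
  have -> : psi = (- c) \*: (tan \o theta).
    by apply/funext => x; rewrite /psi/= /GRing.scale/= mulNr.
  by have := is_deriveZ (- c) dtan; rewrite /GRing.scale/= mulNr.
have acpsi : absolutely_continuous a b psi.
  apply: (@lipschitz_absolutely_continuous _ _ _ _ (c ^+ 2 / k ^+ 2)).
    by rewrite divr_ge0 ?sqr_ge0.
  apply: (bounded_derivative_lipschitz dpsiP) => t tab.
  rewrite normrN mulrCA -expr2 mulrC normrM !ger0_norm ?sqr_ge0//; last first.
    by rewrite invr_ge0 sqr_ge0.
  rewrite ler_wpM2l ?sqr_ge0// lef_pV2 ?posrE ?exprn_gt0 ?cos_gt0//.
  by rewrite lerXn2r ?nnegrE ?(ltW k0) ?(ltW (cos_gt0 _ tab))// coskP.
(* F vanishes at both endpoints along with eta, so its derivative integrates to 0 and may be added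
   to the integrand. *)
pose F := (eta \* eta) \* psi.
have acF : absolutely_continuous a b F.
  by do 2?apply: absolutely_continuousM => //; exact: ltW.
have [iF intF] := absolutely_continuous_FTC (ltW ab) acF.
have ieta2 := integrable_sqr_absolutely_continuous (ltW ab) aceta.
have ideta2 := L2_integrable_sqr L2eta.
pose u t := c ^+ 2 * eta t ^+ 2 + derive1 F t.
have ic : mu.-integrable `[a, b] (fun t => (c ^+ 2)%:E * (eta t ^+ 2)%:E)%E.
  exact: integrableZl.
have iu : mu.-integrable `[a, b] (EFin \o u).
  rewrite (_ : EFin \o u = (fun t => (c ^+ 2)%:E * (eta t ^+ 2)%:E)%E
    \+ (EFin \o derive1 F))%E; last exact/funext.
  exact: integrableD.
have -> : ((c ^+ 2)%:E * \int[mu]_(t in `[a, b]) (eta t ^+ 2)%:E =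
    \int[mu]_(t in `[a, b]) (u t)%:E)%E.
  under [RHS]eq_integral do rewrite /u EFinD EFinM.
  by rewrite integralD// intF integralZl// /F/= etaa etab !mul0r subrr adde0.
apply: ae_le_integral => //; apply: ae_itv_oo_cc.
have aef := @ae_filter_ringOfSetsType _ _ _ mu.
apply: filterS (absolutely_continuous_ae_derivable (ltW ab) aceta) => t Hd tab.
have tab' : t \in `[a, b] by exact: subset_itv_oo_cc tab.
have /derivableP deta := Hd tab; have dpsit := dpsiP _ tab'.
have dF := is_deriveM (is_deriveM deta deta) dpsit.
(* The Riccati equation, from 1 / cos^2 = 1 + tan^2. *)
have psi2 : dpsi t = - (c ^+ 2 + psi t ^+ 2).
  by rewrite /dpsi cos2_tan2 ?gt_eqF ?cos_gt0// /psi; ring.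
rewrite /u derive1E (@derive_val _ _ _ _ _ _ _ dF) /GRing.scale/= -derive1E psi2.
rewrite -subr_ge0.
rewrite (_ : _ - _ = (derive1 eta t - eta t * psi t) ^+ 2) ?sqr_ge0//.
by rewrite -[(eta * eta) t]/(eta t * eta t); ring.
Qed.

End poincare.

(** * The optimal constant in Poincare's inequality *)

Section sharp_poincare.
Variable R : realType.
Implicit Types (a b c t C : R) (eta : R -> R).

Local Notation mu := (@lebesgue_measure R).

Lemma poincare a b : a < b ->
  poincare_inequality a b (pi ^+ 2 / (b - a) ^+ 2).
Proof.
move=> ab eta H10eta; have [aceta L2eta _ _] := H10eta.
have L0 : 0 < b - a by rewrite subr_gt0.
have w0 : 0 < pi / (b - a) by rewrite divr_gt0// pi_gt0.
have sub c : 0 < c -> c < 1 -> (((c * (pi / (b - a))) ^+ 2)%:E *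
    \int[mu]_(t in `[a, b]) (eta t ^+ 2)%:E <=
    \int[mu]_(t in `[a, b]) (derive1 eta t ^+ 2)%:E)%E.
  move=> c0 c1; apply: poincare_subcritical => //; first exact: mulr_gt0.
  by rewrite -mulrA divfK ?gt_eqF// gtr_pMl ?pi_gt0.
have Ifin : (\int[mu]_(t in `[a, b]) (eta t ^+ 2)%:E)%E \is a fin_num.
  apply: integrable_fin_num => //.
  exact: integrable_sqr_absolutely_continuous (ltW ab) aceta.
have Jfin : (\int[mu]_(t in `[a, b]) (derive1 eta t ^+ 2)%:E)%E \is a fin_num.
  by apply: integrable_fin_num => //; exact: L2_integrable_sqr.
rewrite -expr_div_n; move: sub.
rewrite -(fineK Ifin) -(fineK Jfin); set I := fine _; set J := fine _ => sub.
have {}sub c : 0 < c -> c < 1 -> c ^+ 2 * ((pi / (b - a)) ^+ 2 * I) <= J.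
  by move=> c0 c1; have := sub c c0 c1; rewrite -EFinM lee_fin exprMn mulrA.
have J0 : 0 <= J by apply: fine_ge0; apply: integral_ge0 => t _; rewrite lee_fin sqr_ge0.
rewrite -EFinM lee_fin; move: sub; set A := _ * I => sub.
rewrite leNgt; apply/negP => JA.
have A0 : 0 < A by exact: le_lt_trans JA.
(* The factor half way between J / A and 1: its square times A still exceeds J, because (A + J)^2 -
   4 A J = (A - J)^2 > 0. *)
have s0 : 0 < (A + J) / (2 * A) by apply: divr_gt0; lra.
have s1 : (A + J) / (2 * A) < 1 by rewrite ltr_pdivrMr; lra.
have := sub _ s0 s1.
have -> : ((A + J) / (2 * A)) ^+ 2 * A = (A + J) ^+ 2 / (4 * A) by field; lra.
have AJ : 0 < (A - J) ^+ 2 by rewrite exprn_gt0// subr_gt0.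
by rewrite ler_pdivrMr; [nra|lra].
Qed.

(** * The sine arch as extremal function *)

Section sine.
Variables (a b : R).
Hypothesis ab : a < b.

Let w := pi / (b - a).
Let theta t := w * (t - a).

Let w_gt0 : 0 < w. Proof. by rewrite divr_gt0 ?pi_gt0 ?subr_gt0. Qed.

Let sine_archE : sine_arch a b = sin \o theta.
Proof. by apply/funext => t /=; rewrite /sine_arch mulrAC. Qed.

Let dtheta t : is_derive t 1 theta w. Proof. exact: is_derive_affine. Qed.

Let dsin t : is_derive t 1 (sin \o theta) (cos (theta t) * w).
Proof. exact: is_derive1_comp. Qed.

Let dcos t : is_derive t 1 (cos \o theta) (- sin (theta t) * w).
Proof. exact: is_derive1_comp. Qed.

Let acsin : absolutely_continuous a b (sin \o theta).
Proof.
apply: (@lipschitz_absolutely_continuous _ _ _ _ w); first exact: ltW.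
apply: (@bounded_derivative_lipschitz _ _ _ _ (fun t => cos (theta t) * w)).
  by move=> t _; exact: dsin.
move=> t _; rewrite normrM (gtr0_norm w_gt0) ler_piMl ?(ltW w_gt0)//.
by rewrite ler_norml cos_geN1 cos_le1.
Qed.

Let accos : absolutely_continuous a b (cos \o theta).
Proof.
apply: (@lipschitz_absolutely_continuous _ _ _ _ w); first exact: ltW.
apply: (@bounded_derivative_lipschitz _ _ _ _ (fun t => - sin (theta t) * w)).
  by move=> t _; exact: dcos.
move=> t _; rewrite normrM (gtr0_norm w_gt0) ler_piMl ?(ltW w_gt0)//.
by rewrite normrN ler_norml sin_geN1 sin_le1.
Qed.

Let theta_a : theta a = 0. Proof. by rewrite /theta subrr mulr0. Qed.

Let theta_b : theta b = pi.
Proof. by rewrite /theta divfK// gt_eqF// subr_gt0. Qed.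

Let derive1_sine : derive1 (sin \o theta) = w \*o (cos \o theta).
Proof.
by apply/funext => t; rewrite derive1E (@derive_val _ _ _ _ _ _ _ (dsin t))/= mulrC.
Qed.

Let isin : mu.-integrable `[a, b] (EFin \o (fun t => sin (theta t) ^+ 2)).
Proof. exact: integrable_sqr_absolutely_continuous (ltW ab) acsin. Qed.

Let icos : mu.-integrable `[a, b] (EFin \o (fun t => cos (theta t) ^+ 2)).
Proof. exact: integrable_sqr_absolutely_continuous (ltW ab) accos. Qed.

(* [(sin cos)' = w (cos^2 - sin^2)] integrates to 0. *)
Let integral_cos_sin : (\int[mu]_(t in `[a, b]) (cos (theta t) ^+ 2)%:E =
  \int[mu]_(t in `[a, b]) (sin (theta t) ^+ 2)%:E)%E.
Proof.
pose g := (sin \o theta) \* (cos \o theta).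
have acg : absolutely_continuous a b g by exact: absolutely_continuousM (ltW ab) _ _.
have [_] := absolutely_continuous_FTC (ltW ab) acg.
have dg t : derive1 g t = w * (cos (theta t) ^+ 2 - sin (theta t) ^+ 2).
  have dgt := is_deriveM (dsin t) (dcos t).
  rewrite derive1E (@derive_val _ _ _ _ _ _ _ dgt) /GRing.scale/=; ring.
under eq_integral do rewrite dg EFinM.
have icossin : mu.-integrable `[a, b]
  (fun t => (cos (theta t) ^+ 2 - sin (theta t) ^+ 2)%:E).
  rewrite (_ : (fun t => _) = (fun t => (cos (theta t) ^+ 2)%:E)
    \- (fun t => (sin (theta t) ^+ 2)%:E))%E; last exact/funext.
  exact: integrableB.
rewrite integralZl// /g/= theta_a theta_b sin0 sinpi !mul0r subrr => /eqP.
rewrite mule_eq0 eqe gt_eqF//= => /eqP.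
under eq_integral do rewrite EFinB.
rewrite integralB//.
have cosfin : (\int[mu]_(t in `[a, b]) (cos (theta t) ^+ 2)%:E)%E \is a fin_num.
  exact: integrable_fin_num.
have sinfin : (\int[mu]_(t in `[a, b]) (sin (theta t) ^+ 2)%:E)%E \is a fin_num.
  exact: integrable_fin_num.
rewrite -(fineK cosfin) -(fineK sinfin) -EFinB => -[] /eqP.
by rewrite subr_eq0 => /eqP ->.
Qed.

(** sin^2 + cos^2 = 1 integrates to b - a, and the two summands have equal integrals. *)
Lemma integral_sine_arch_sqr :
  (\int[mu]_(t in `[a, b]) (sine_arch a b t ^+ 2)%:E = ((b - a) / 2)%:E)%E.
Proof.
have : (\int[mu]_(t in `[a, b]) ((sin (theta t) ^+ 2)%:E + (cos (theta t) ^+ 2)%:E)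
    = (b - a)%:E)%E.
  under eq_integral do rewrite -EFinD addrC cos2Dsin2.
  by rewrite integral_cst// mul1e; exact: lebesgue_measure_cc (ltW ab).
rewrite integralD// integral_cos_sin sine_archE.
have /fineK <- : (\int[mu]_(t in `[a, b]) (sin (theta t) ^+ 2)%:E)%E \is a fin_num.
  exact: integrable_fin_num.
by rewrite -EFinD => -[<-]; rewrite mulrDl -splitr.
Qed.

(** The derivative is w cos theta, and cos^2 and sin^2 have the same integral. *)
Lemma integral_derive1_sine_arch_sqr :
  (\int[mu]_(t in `[a, b]) (derive1 (sine_arch a b) t ^+ 2)%:E =
   (w ^+ 2)%:E * \int[mu]_(t in `[a, b]) (sine_arch a b t ^+ 2)%:E)%E.
Proof.
rewrite sine_archE derive1_sine -integral_cos_sin -integralZl//.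
by apply: eq_integral => t _; rewrite /= exprMn EFinM.
Qed.

Lemma H10_sine_arch : H10 a b (sine_arch a b).
Proof.
split; rewrite sine_archE//=; first last.
- by rewrite theta_b sinpi.
- by rewrite theta_a sin0.
- apply/L2P; split.
    exact: absolutely_continuous_measurable_derive1 (ltW ab) acsin.
  rewrite -sine_archE integral_derive1_sine_arch_sqr integral_sine_arch_sqr.
  by rewrite ltry.
Qed.

End sine.

(** Test the inequality on the sine arch and divide by the positive integral (b - a) / 2 of its
    square. *)
Lemma poincare_optimal a b C : a < b -> poincare_inequality a b C ->
  C <= pi ^+ 2 / (b - a) ^+ 2.
Proof.
move=> ab /(_ _ (H10_sine_arch ab)).
rewrite integral_derive1_sine_arch_sqr// integral_sine_arch_sqr// -!EFinM lee_fin.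
by rewrite ler_pM2r ?divr_gt0 ?subr_gt0// expr_div_n.
Qed.

End sharp_poincare.

(** * The gap of the kinetic action *)

Section kinetic_action_gap.
Variable R : realType.
Implicit Types (a b h k t v x y : R) (gamma eta : R -> R).

Local Notation mu := (@lebesgue_measure R).

Lemma integrable_cst_cc a b k : a <= b -> mu.-integrable `[a, b] (cst k%:E).
Proof.
move=> ab; apply/integrableP; split; first exact: measurable_cst.
rewrite integral_cst//; apply: lte_mul_pinfty => //.
by rewrite -[X in (X < _)%E]/(mu _) lebesgue_measure_cc// ltry.
Qed.

Definition sinh x : R := (expR x - expR (- x)) / 2.

Let is_derive_expRN x : is_derive x 1 (expR \o -%R) (expR (- x) * -1).
Proof. by apply: is_derive1_comp; exact: is_deriveN. Qed.

Lemma is_derive_cosh x : is_derive x 1 (@cosh R) (sinh x).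
Proof.
have := is_deriveZ 2^-1 (is_deriveD (is_derive_expR x) (is_derive_expRN x)).
rewrite /GRing.scale/= mulrN1 mulrC; congr (is_derive _ _ _ _).
by apply/funext => t; rewrite /cosh/= mulrC.
Qed.

Lemma is_derive_sinh x : is_derive x 1 sinh (cosh x).
Proof.
have := is_deriveZ 2^-1 (is_deriveB (is_derive_expR x) (is_derive_expRN x)).
rewrite /GRing.scale/= mulrN1 opprK mulrC; congr (is_derive _ _ _ _).
by apply/funext => t; rewrite /sinh/= mulrC.
Qed.

Lemma cosh_ge1 x : 1 <= cosh x.
Proof.
rewrite /cosh; have := expR_ge1Dx x; have := expR_ge1Dx (- x); lra.
Qed.

(** The mean value theorem, with sinh' = cosh >= 1. *)
Lemma sinhB_ge x y : x <= y -> y - x <= sinh y - sinh x.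
Proof.
move=> xy.
have [|z _ ->] := @MVT_segment _ sinh (@cosh R) _ _ xy (fun x _ => is_derive_sinh x).
  apply: derivable_within_continuous => z _.
  by apply: ex_derive; exact: is_derive_sinh.
by rewrite ler_peMl ?cosh_ge1// subr_ge0.
Qed.

(* [cosh x - x^2 / 2] is convex since its derivative [sinh x - x] is
   nondecreasing. *)
Lemma cosh_tangent_ge v h :
  cosh v + sinh v * h + 2^-1 * h ^+ 2 <= cosh (v + h).
Proof.
pose g x := cosh x - 2^-1 * x ^+ 2.
have dg x : is_derive x 1 g (sinh x - x).
  have dsqr := is_deriveZ 2^-1 (is_deriveM (is_derive_id x 1) (is_derive_id x 1)).
  have := is_deriveB (is_derive_cosh x) dsqr.
  by congr (is_derive _ _ _ _); rewrite /GRing.scale/=; lra.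
have cg x y : {within `[x, y], continuous g}.
  by apply: derivable_within_continuous => z _; apply: ex_derive.
(* By the mean value theorem g(v + h) - g(v) = g'(z) h with z between v and v + h, and (g'(z) -
   g'(v)) h >= 0 whatever the sign of h. *)
have [h0|h0] := leP 0 h.
- have vh : v <= v + h by rewrite lerDl.
  have [z] := MVT_segment vh (fun x _ => dg x) (cg _ _).
  rewrite in_itv/= => /andP[vz _]; have := sinhB_ge vz.
  by rewrite /g; nra.
- have vh : v + h <= v by rewrite gerDl ltW.
  have [z] := MVT_segment vh (fun x _ => dg x) (cg _ _).
  rewrite in_itv/= => /andP[_ zv]; have := sinhB_ge zv.
  by rewrite /g; nra.
Qed.

Section bounds.
Variables (a b xa xb : R) (gamma : R -> R).
Hypothesis ab : a < b.
Hypotheses (xa0 : 0 < xa) (xb0 : 0 < xb).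

Let gs := gamma_star a b xa xb.
Let v := (ln xb - ln xa) / (b - a).
Let eta t := ln (gamma t) - ln (gs t).

Let ln_gs t : ln (gs t) = v * (t - a) + ln xa.
Proof. by rewrite /gs /gamma_star expRK addrC /v; ring. Qed.

Let dln_gs t : is_derive t 1 (log_coord gs) v.
Proof.
have := is_deriveD (is_derive_affine v a t) (is_derive_cst (ln xa) t 1).
rewrite addr0; congr (is_derive _ _ _ _).
by apply/funext => x; rewrite /log_coord ln_gs.
Qed.

Let derive1_ln_gs t : derive1 (log_coord gs) t = v.
Proof. by rewrite derive1E (@derive_val _ _ _ _ _ _ _ (dln_gs t)). Qed.

Let dgs t : is_derive t 1 gs (gs t * v).
Proof.
have := is_derive1_comp (is_derive_expR (log_coord gs t)) (dln_gs t).
rewrite /log_coord lnK ?posrE ?expR_gt0//; congr (is_derive _ _ _ _).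
by apply/funext => x /=; rewrite lnK// posrE expR_gt0.
Qed.

Let acgs : absolutely_continuous a b gs.
Proof.
(* The derivative of [gs] is [gs] times v, and on [a, b] the exponent v (t - a) + ln xa of [gs] is
   at most |v| (b - a) + ln xa. *)
apply: (@lipschitz_absolutely_continuous _ _ _ _
  (expR (`|v| * (b - a) + ln xa) * `|v|)); first by rewrite mulr_ge0 ?expR_ge0.
apply: (@bounded_derivative_lipschitz _ _ _ _ (fun t => gs t * v)).
  by move=> t _; exact: dgs.
move=> t; rewrite in_itv/= => /andP[at' tb].
have gsE : gs t = expR (v * (t - a) + ln xa).
  by rewrite -ln_gs lnK// posrE expR_gt0.
rewrite normrM ger0_norm ?expR_ge0// ler_wpM2r// gsE ler_expR lerD2r.
rewrite (le_trans (ler_norm _))// normrM ler_wpM2l// ger0_norm; lra.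
Qed.

Lemma kinetic_action_gamma_star :
  kinetic_action a b gs = ((cosh v - 1) * (b - a))%:E.
Proof.
rewrite /kinetic_action; under eq_integral do rewrite derive1_ln_gs.
by rewrite integral_cst// EFinM; congr (_ * _)%E; exact: lebesgue_measure_cc (ltW ab).
Qed.

Lemma kinetically_admissible_gamma_star : kinetically_admissible a b gs.
Proof.
split; last by rewrite kinetic_action_gamma_star ltry.
split => //; first by move=> t _; exact: expR_gt0.
apply/L2P; split; first exact: absolutely_continuous_measurable_derive1 (ltW ab) acgs.
have igs := integrable_sqr_absolutely_continuous (ltW ab) acgs.
under eq_integral => t _.
  rewrite derive1E (@derive_val _ _ _ _ _ _ _ (dgs t)) exprMn mulrC EFinM; over.
rewrite integralZl//; apply: lte_mul_pinfty; rewrite ?lee_fin ?sqr_ge0//.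
have : (\int[mu]_(t in `[a, b]) (gs t ^+ 2)%:E)%E \is a fin_num.
  exact: integrable_fin_num.
by rewrite fin_numElt => /andP[].
Qed.

Hypothesis gammaP : kinetically_admissible a b gamma.
Hypotheses (gammaa : gamma a = xa) (gammab : gamma b = xb).

Let xi := log_coord gamma.

Let acxi : absolutely_continuous a b xi.
Proof.
by have [[acg g0 _] _] := gammaP; exact: absolutely_continuous_ln (ltW ab) _ _.
Qed.

Let aceta : absolutely_continuous a b eta.
Proof.
apply: absolutely_continuousB acxi _.
apply: absolutely_continuous_ln (ltW ab) acgs _ => t _; exact: expR_gt0.
Qed.

Let etaa : eta a = 0.
Proof. by rewrite /eta ln_gs gammaa subrr mulr0 add0r subrr. Qed.

Let etab : eta b = 0.
Proof. by rewrite /eta ln_gs gammab /v divfK ?subrK ?subrr// subr_eq0 gt_eqF. Qed.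

(** [eta] is the difference of [xi] and an affine function of slope v. *)
Let derive1_xi :
  {ae mu, forall t, `[a, b]%classic t -> derive1 xi t = v + derive1 eta t}.
Proof.
apply: ae_itv_oo_cc; have aef := @ae_filter_ringOfSetsType _ _ _ mu.
apply: filterS (absolutely_continuous_ae_derivable (ltW ab) aceta) => t Hd tab.
have xiE : xi = log_coord gs + eta.
  by apply/funext => x; rewrite /eta -[RHS]/(_ + _) addrC subrK.
have dsum := is_deriveD (dln_gs t) (derivableP (Hd tab)).
by rewrite xiE !derive1E (@derive_val _ _ _ _ _ _ _ dsum).
Qed.

Let mcosh : measurable_fun `[a, b] (fun t => cosh (derive1 xi t) - 1).
Proof.
apply: measurable_funB => //.
apply: (@measurableT_comp _ _ _ _ _ _ (@cosh R)); last first.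
  exact: absolutely_continuous_measurable_derive1 (ltW ab) acxi.
apply: continuous_measurable_fun => x.
apply: differentiable_continuous; apply/derivable1_diffP.
by apply: ex_derive; exact: is_derive_cosh.
Qed.

Let icosh : mu.-integrable `[a, b] (fun t => (cosh (derive1 xi t) - 1)%:E).
Proof.
apply/integrableP; split; first exact/measurable_EFinP.
have [_ +] := gammaP; congr (_ < _)%E; apply: eq_integral => t _ /=.
by rewrite ger0_norm// subr_ge0 cosh_ge1.
Qed.

(** Finiteness of the kinetic action of gamma controls the square of eta'. *)
Let L2eta : L2 a b (derive1 eta).
Proof.
have meta := absolutely_continuous_measurable_derive1 (ltW ab) aceta.
apply/L2P; split => //.
(* With h = eta' and s = sinh v, [cosh_tangent_ge] and cosh v >= 1 give h^2 / 2 <= cosh (v + h) - 1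
   - s h, while (2 s + h)^2 >= 0 gives - s h <= h^2 / 4 + s^2; hence h^2 <= w. *)
pose w t := 4 * (cosh (derive1 xi t) - 1) + 4 * sinh v ^+ 2.
have iw : mu.-integrable `[a, b] (EFin \o w).
  rewrite (_ : EFin \o w = (fun t => 4%:E * (cosh (derive1 xi t) - 1)%:E)
    \+ cst (4 * sinh v ^+ 2)%:E)%E; last exact/funext.
  apply: integrableD => //; first exact: integrableZl.
  exact: integrable_cst_cc (ltW ab).
have woo : (\int[mu]_(t in `[a, b]) (w t)%:E < +oo)%E.
  have : (\int[mu]_(t in `[a, b]) (w t)%:E)%E \is a fin_num.
    exact: integrable_fin_num.
  by rewrite fin_numElt => /andP[].
apply: le_lt_trans woo; apply: ae_ge0_le_integral => //.
- by move=> t _; rewrite lee_fin sqr_ge0.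
- by apply/measurable_EFinP; exact: measurable_funX.
- by move=> t _; rewrite lee_fin addr_ge0// mulr_ge0// ?sqr_ge0// subr_ge0 cosh_ge1.
- exact: measurable_int iw.
- have aef := @ae_filter_ringOfSetsType _ _ _ mu.
  apply: filterS derive1_xi => t H /H; rewrite lee_fin /w => ->.
  have := cosh_tangent_ge v (derive1 eta t); have := cosh_ge1 v.
  have := sqr_ge0 (2 * sinh v + derive1 eta t); lra.
Qed.

(** The four conditions are [aceta], [L2eta], [etaa] and [etab]. *)
Lemma H10_log_ratio : H10 a b eta.
Proof. by []. Qed.

(** Integrates [cosh_tangent_ge] at h = eta'. The action of [gs] is finite, so it can be moved to
    the other side. *)
Lemma kinetic_action_gap : (2^-1%:E *
    \int[mu]_(t in `[a, b]) (derive1 eta t ^+ 2)%:E <=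
  kinetic_action a b gamma - kinetic_action a b gs)%E.
Proof.
rewrite kinetic_action_gamma_star leeBrDr//.
have [ideta intdeta] := absolutely_continuous_FTC (ltW ab) aceta.
have ideta2 := L2_integrable_sqr L2eta.
have iq : mu.-integrable `[a, b]
    (fun t => 2^-1%:E * (derive1 eta t ^+ 2)%:E)%E by exact: integrableZl.
have il : mu.-integrable `[a, b]
    (fun t => (sinh v)%:E * (derive1 eta t)%:E)%E by exact: integrableZl.
have ic := integrable_cst_cc (cosh v - 1) (ltW ab).
pose u t := 2^-1 * derive1 eta t ^+ 2 + sinh v * derive1 eta t + (cosh v - 1).
have uE : EFin \o u = ((fun t => 2^-1%:E * (derive1 eta t ^+ 2)%:E)
    \+ (fun t => (sinh v)%:E * (derive1 eta t)%:E) \+ cst (cosh v - 1)%:E)%E.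
  exact/funext.
have iu : mu.-integrable `[a, b] (EFin \o u).
  by rewrite uE; apply: integrableD => //; exact: integrableD.
have -> : (2^-1%:E * \int[mu]_(t in `[a, b]) (derive1 eta t ^+ 2)%:E +
    ((cosh v - 1) * (b - a))%:E = \int[mu]_(t in `[a, b]) (u t)%:E)%E.
  under [RHS]eq_integral do rewrite -[(u _)%:E]/((EFin \o u) _) uE/=.
  rewrite integralD//; last exact: integrableD.
  (* The linear term contributes sinh v times eta b - eta a, which is 0. *)
  rewrite integralD// !integralZl// intdeta etaa etab subrr mule0 adde0.
  rewrite integral_cst// EFinM; congr (_ + _ * _)%E.
  exact/esym/(lebesgue_measure_cc (ltW ab)).
apply: ae_le_integral => //.
have aef := @ae_filter_ringOfSetsType _ _ _ mu.
apply: filterS derive1_xi => t H /H ->; rewrite /u.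
by have := cosh_tangent_ge v (derive1 eta t); lra.
Qed.

End bounds.

End kinetic_action_gap.

Theorem corollary4p15 (R : realType) (a b : R) (hab : a < b) :
  let mu := @lebesgue_measure R in
  let C0 : R := pi ^+ 2 / (b - a) ^+ 2 in
  (forall (xa xb : R) (gamma : R -> R),
    0 < xa -> 0 < xb ->
    kinetically_admissible a b gamma -> gamma a = xa -> gamma b = xb ->
    let gs := gamma_star a b xa xb in
    let eta := fun t : R => ln (gamma t) - ln (gs t) in
    [/\ kinetically_admissible a b gs,
        H10 a b eta,
        (kinetic_action a b gamma - kinetic_action a b gs >=
         (2^-1)%:E * \int[mu]_(t in `[a, b]) (derive1 eta t ^+ 2)%:E)%E,
        ((2^-1)%:E * \int[mu]_(t in `[a, b]) (derive1 eta t ^+ 2)%:E >=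
         (pi ^+ 2 / (2 * (b - a) ^+ 2))%:E *
           \int[mu]_(t in `[a, b]) (eta t ^+ 2)%:E)%E
      & ((pi ^+ 2 / (2 * (b - a) ^+ 2))%:E *
           \int[mu]_(t in `[a, b]) (eta t ^+ 2)%:E =
         (pi ^+ 2 / (2 * (b - a) ^+ 2))%:E *
           L2norm a b (fun t => ln (gamma t / gs t)) ^+ 2)%E]) /\
  [/\ poincare_inequality a b C0,
      (forall C : R, poincare_inequality a b C -> C <= C0),
      H10 a b (sine_arch a b),
      (0 < \int[mu]_(t in `[a, b]) (sine_arch a b t ^+ 2)%:E)%E
    & (\int[mu]_(t in `[a, b]) (derive1 (sine_arch a b) t ^+ 2)%:E =
       C0%:E * \int[mu]_(t in `[a, b]) (sine_arch a b t ^+ 2)%:E)%E].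
Proof.
move=> mu C0; split.
- move=> xa xb gamma xa0 xb0 gammaP gammaa gammab gs eta.
  have H10eta : H10 a b eta by exact: H10_log_ratio.
  split.
  + exact: kinetically_admissible_gamma_star.
  + exact: H10eta.
  + exact: kinetic_action_gap.
  + have -> : pi ^+ 2 / (2 * (b - a) ^+ 2) = 2^-1 * C0.
      by rewrite /C0 invfM mulrCA.
    by rewrite EFinM -muleA lee_pmul2l// ?lte_fin//; exact: poincare.
  (* On [a, b] both gamma and [gs] are positive, so the logarithm of their quotient is eta. *)
  + congr (_ * _)%E; rewrite L2norm_sqr; apply: eq_integral => t; rewrite inE => tab.
    have [[_ gamma_gt0 _] _] := gammaP.
    by rewrite ln_div ?posrE ?gamma_gt0 ?expR_gt0.
- split.
  + exact: poincare.
  + by move=> C; exact: poincare_optimal.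
  + exact: H10_sine_arch.
  + by rewrite integral_sine_arch_sqr// lte_fin divr_gt0// subr_gt0.
  + by rewrite integral_derive1_sine_arch_sqr// expr_div_n.
Qed.
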